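(* An Abelian group $G$ is finitely Bassian if and only if $G = A \oplus C$, where $A$ is a divisible hull of a finite group and $C$ is a Bassian group.
   Context: All groups are Abelian, written additively. An injection between groups means an injective homomorphism. A group $G$ is Bassian if, for every subgroup $N \leq G$, the existence of an injection $G \to G/N$ implies $N = \{0\}$. A group $G$ is finitely Bassian if, for every subgroup $N \leq G$, the existence of an injection $G \to G/N$ implies that $N$ is finite. The divisible hull of a group $X$ is a minimal divisible group containing $X$ (equivalently, a divisible group containing $X$ as an essential subgroup); it is unique up to isomorphism. Finite groups are allowed to be trivial. *)

(* Defs.v *)
From mathcomp Require Import all_boot all_order all_algebra.
From mathcomp Require Import all_classical.
Set Implicit Arguments.
Unset Strict Implicit.
Unset Printing Implicit Defensive.
Import GRing.Theory.
Local Open Scope ring_scope.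

(* A subgroup N of G is a [zmodClosed G], whose underlying predicate is boolean;
   under the classical axioms of [boolp] every Prop-valued subgroup predicate
   is of this form, so nothing is lost.  [{ideal_quot N}], despite its
   name, is the quotient group G/N for any such N. *)

Definition injects_into (G H : zmodType) : Prop :=
  exists f : {additive G -> H}, injective f.

Definition Bassian (G : zmodType) : Prop :=
  forall N : zmodClosed G, injects_into G {ideal_quot N} -> N =i pred1 0.

Definition finitely_Bassian (G : zmodType) : Prop :=
  forall N : zmodClosed G, injects_into G {ideal_quot N} ->
    finite_set [set` N]%classic.

Definition divisible_subgroup (G : zmodType) (D : zmodClosed G) : Prop :=
  forall (n : nat) (x : G), (0 < n)%N -> x \in D ->
    exists2 y, y \in D & y *+ n = x.

Definition divisible (G : zmodType) : Prop :=
  forall (n : nat) (x : G), (0 < n)%N -> exists y : G, y *+ n = x.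

(* X is regarded as contained in A through an embedding i, and A is minimal
   among the divisible groups containing i(X). *)
Definition divisible_hull (X A : zmodType) : Prop :=
  exists i : {additive X -> A},
    [/\ injective i,
        divisible A
      & forall D : zmodClosed A, divisible_subgroup D ->
          (forall x : X, i x \in D) -> forall a : A, a \in D].

Definition is_direct_sum (G A C : zmodType) : Prop :=
  exists f : {additive G -> (A * C)%type}, bijective f.

(* Main.v *)
(** Write D for the maximal divisible torsion subgroup of G.  If f : G -> G/N is
   injective, then lifting z |-> f z repeatedly from a non-torsion z0 in N gives an
   infinite independent sequence; so N is torsion when G has finite torsion-free
   rank.  If moreover all G[p] are finite, a pigeonhole argument gives N_p = 0
   whenever D[p] = 0, and counting in the finite groups G[n^k] shows that each
   primary part of N is finite.  So if D has only finitely many elements of prime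
   order, G is finitely Bassian, and if D = 0 it is Bassian.
   Conversely, if P is a group with embeddings i : P -> G and j : P -> E, E
   divisible, and a surjection q : P -> E, then G embeds in G / i(ker q): extending
   j to a : G -> E and q to s : E -> E with s j = q, and identifying E with
   i(P) / i(ker q), the map x |-> a x + [x] - s (a x) is injective.  Choosing P
   so that ker q is infinite contradicts finite Bassianness as soon as G has infinite
   torsion-free rank, an infinite G[p], or infinitely many elements of prime order in
   D; with P = E = D and q = p it shows D = 0 for Bassian G.  Finally D splits off. *)

Require Import Defs.
From mathcomp Require Import all_boot all_order all_algebra.
From HB Require Import structures.
From mathcomp Require Import fingroup all_classical ring.
Set Implicit Arguments.
Unset Strict Implicit.
Unset Printing Implicit Defensive.
Import GRing.Theory Num.Theory.
Local Open Scope ring_scope.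

(** * Subgroups and extension of homomorphisms *)

Definition is_subgroup (G : zmodType) (P : G -> Prop) : Prop :=
  P 0 /\ forall x y, P x -> P y -> P (x - y).

Definition subgroup_pred (G : zmodType) (P : G -> Prop) : {pred G} :=
  fun x => `[< P x >].

Lemma subgroup_predP (G : zmodType) (P : G -> Prop) :
  is_subgroup P -> zmod_closed (subgroup_pred P).
Proof.
move=> [P0 PB]; split=> [|x y]; first exact/asboolP.
by move=> /asboolP Px /asboolP Py; apply/asboolP/PB.
Qed.

Definition subgroup_of (G : zmodType) (P : G -> Prop) (h : is_subgroup P)
  : zmodClosed G :=
  HB.pack (subgroup_pred P)
    (GRing.isZmodClosed.Build G (subgroup_pred P) (subgroup_predP h)).

Lemma in_subgroup (G : zmodType) (P : G -> Prop) (h : is_subgroup P) x :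
  (x \in subgroup_of h) <-> P x.
Proof. by split=> /asboolP. Qed.

Record subgroup_type (G : zmodType) (D : zmodClosed G) :=
  SubgroupElt { subgroup_val : G; subgroup_valP : subgroup_val \in D }.

HB.instance Definition _ (G : zmodType) (D : zmodClosed G) :=
  [isSub for @subgroup_val G D].
HB.instance Definition _ (G : zmodType) (D : zmodClosed G) :=
  [Choice of subgroup_type D by <:].
HB.instance Definition _ (G : zmodType) (D : zmodClosed G) :=
  [SubChoice_isSubZmodule of subgroup_type D by <:].

Lemma additive_of (U V : zmodType) (f : U -> V) :
  {morph f : x y / x - y} -> {g : {additive U -> V} | forall x, g x = f x}.
Proof.
move=> fB.
pose F := GRing.isZmodMorphism.Build U V f fB.
pose g : {additive U -> V} := HB.pack f F.
by exists g.
Qed.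

Lemma quotient_map (G : zmodType) (N : zmodClosed G) :
  exists p : {additive G -> {ideal_quot N}},
    (forall x, p x = 0 <-> x \in N) /\ (forall y, exists x, p x = y).
Proof.
exists \pi_{ideal_quot N}%qT; split=> [x|y]; last first.
  by exists (generic_quotient.repr y); rewrite /= reprK.
rewrite -[x in x \in N]subr0 Quotient.idealrBE.
set p : {additive G -> {ideal_quot N}} := \pi_{ideal_quot N}%qT.
by rewrite -[X in p x = X](raddf0 p); split=> /eqP.
Qed.

Lemma maximal_subgroup_avoiding (V : zmodType) (R0 B : set V) :
  is_subgroup R0 -> (forall x, R0 x -> ~ B x) ->
  exists M : set V, [/\ is_subgroup M, forall x, R0 x -> M x,
    forall x, M x -> ~ B x &
    forall M' : set V, is_subgroup M' -> (forall x, M x -> M' x) ->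
      (forall x, M' x -> ~ B x) -> forall x, M' x -> M x].
Proof.
move=> sR0 R0B.
pose good (R : set V) :=
  [/\ is_subgroup R, forall x, R0 x -> R x & forall x, R x -> ~ B x].
pose F (R : set V) := R = set0 \/ good R.
have [|M [FM maxM]] := @Zorn_bigcup _ F.
  move=> C CF Ctot.
  have [Call0|] := pselect (forall R, C R -> R = set0).
    left; apply/seteqP; split=> // z [R CR Rz].
    by move: Rz; rewrite (Call0 R CR).
  move=> /existsNP[R1 /not_implyP[CR1 R1n0]]; right.
  have nz R z : C R -> R z -> good R.
    by move=> CR Rz; case: (CF R CR) => // R_0; move: Rz; rewrite R_0.
  have [[R10 _] R01 _] : good R1 by case: (CF R1 CR1).
  split; [split|by move=> x /R01; exists R1|].
  - by exists R1.
  - move=> x y [Rx CRx Rxx] [Ry CRy Ryy].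
    have [sub|sub] := Ctot Rx Ry CRx CRy.
      exists Ry => //; have [[_ RB] _ _] := nz _ _ CRy Ryy.
      by apply: RB => //; exact: sub.
    exists Rx => //; have [[_ RB] _ _] := nz _ _ CRx Rxx.
    by apply: RB => //; exact: sub.
  - by move=> x [R CR Rx]; have [_ _] := nz _ _ CR Rx; apply.
have gM : good M.
  case: FM => // M0; have := maxM R0; case; last by right.
  by rewrite M0; split=> // sub; have [/sub] := sR0.
have [sM R0M MB] := gM; exists M; split=> // M' sM' MM' M'B x M'x.
apply: contrapT => nMx; apply: (maxM M').
  by split=> // sub; apply: nMx; exact: sub.
by right; split=> // y /R0M /MM'.
Qed.

Lemma pairNE (U V : zmodType) (x : U) (y : V) : - (x, y) = (- x, - y).
Proof. by []. Qed.

Lemma pairBE (U V : zmodType) (x u : U) (y v : V) :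
  (x, y) - (u, v) = (x - u, y - v).
Proof. by []. Qed.

Lemma pairMnE (U V : zmodType) (x : U) (y : V) n : (x, y) *+ n = (x *+ n, y *+ n).
Proof. by elim: n => [|n IHn] //; rewrite !mulrS IHn. Qed.

Lemma pairMzE (U V : zmodType) (x : U) (y : V) (k : int) :
  (x, y) *~ k = (x *~ k, y *~ k).
Proof. by case: k => n; rewrite /intmul pairMnE. Qed.

(** Zorn on graphs: a maximal subgroup [M] of G x E that contains all (i u, f u) and meets 0 x E
    trivially is the graph of a partial homomorphism, and divisibility of E makes it total. *)
Lemma additive_extension (P G E : zmodType) (i : {additive P -> G})
    (f : {additive P -> E}) :
  divisible E -> (forall u, i u = 0 -> f u = 0) ->
  exists a : {additive G -> E}, forall u, a (i u) = f u.
Proof.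
move=> divE kif.
pose R0 : set (G * E) := [set z | exists u, z = (i u, f u)]%classic.
pose B : set (G * E) := [set z | z.1 = 0 /\ z.2 <> 0]%classic.
have [||M [[M0 MB] R0M MnB maxM]] := @maximal_subgroup_avoiding _ R0 B.
- split; first by exists 0; rewrite !raddf0.
  by move=> _ _ [u ->] [v ->]; exists (u - v); rewrite !raddfB.
- by move=> _ [u ->] [/= /kif].
have MN x : M x -> M (- x) by move=> Mx; rewrite -sub0r; exact: MB.
have MD x y : M x -> M y -> M (x + y).
  by move=> Mx /MN My; rewrite -[y]opprK; exact: MB.
have MMn x n : M x -> M (x *+ n).
  by move=> Mx; elim: n => [|n IHn]; rewrite ?mulrS //; exact: MD.
have Mfun g e e' : M (g, e) -> M (g, e') -> e = e'.
  move=> Me Me'; apply: contrapT => ne.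
  have /MnB : M (0, e - e') by rewrite -(subrr g); exact: (MB (g, e) (g, e')).
  by apply; split=> //= /eqP; rewrite subr_eq0 => /eqP.
(* The k with k g in the domain of [M] are the multiples of the least positive one, n. Dividing the
   value at n g by n gives a value for g compatible with [M]; if there is no such n, 0 will do. *)
have Mnat g : exists e', forall k : nat,
    (exists e, M (g *+ k, e)) -> M (g *+ k, e' *+ k).
  have [ex|nex] := pselect (exists n, `[< (0 < n)%N /\ exists e, M (g *+ n, e) >]).
    case: (ex_minnP ex) => n /asboolP[n0 [e Me]] nmin.
    have [e' e'n] := divE n e n0; exists e' => k [ek Mek].
    have Mq q : M (g *+ (q * n), e' *+ (q * n)).
      rewrite ![(q * n)%N]mulnC !mulrnA e'n.
      by have := MMn _ q Me; rewrite pairMnE.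
    have := MB _ _ Mek (Mq (k %/ n)%N); rewrite {1}(divn_eq k n) pairBE.
    rewrite mulrnDr addrAC subrr add0r => Mr.
    have kn0 : (k %% n = 0)%N.
      apply/eqP; rewrite -leqn0 leqNgt; apply/negP => r0.
      have : (n <= k %% n)%N by apply: nmin; apply/asboolP; split=> //; eexists; exact: Mr.
      by rewrite leqNgt ltn_mod n0.
    by rewrite (divn_eq k n) kn0 addn0; exact: Mq.
  exists 0 => k [e Me]; have [->|k0] := posnP k; first by rewrite !mulr0n.
  by case: nex; exists k; apply/asboolP; split=> //; exists e.
have Mint g : exists e', forall k : int,
    (exists e, M (g *~ k, e)) -> M (g *~ k, e' *~ k).
  have [e' He'] := Mnat g; exists e' => -[k|k] [e Me]; first by apply: He'; exists e.
  have := MN (g *- k.+1, e) Me => /=; rewrite pairNE opprK => Me'.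
  have : M (g *+ k.+1, e' *+ k.+1) by apply: He'; eexists; exact: Me'.
  by move/MN; rewrite pairNE.
have dom g : exists e, M (g, e).
  have [e' He'] := Mint g; exists e'.
  pose M' : set (G * E) :=
    [set z | exists x (k : int), M x /\ z = x + (g, e') *~ k]%classic.
  apply: (maxM M').
  - split; first by exists 0, 0; rewrite mulr0z addr0.
    move=> _ _ [x [k [Mx ->]]] [y [l [My ->]]]; exists (x - y), (k - l).
    by split; [exact: MB|rewrite mulrzBr opprD addrACA].
  - by move=> x Mx; exists x, 0; rewrite mulr0z addr0.
  - move=> z [[x1 x2] [k [Mx ->]]]; rewrite pairMzE /B /= => -[zx].
    apply; have x1E : x1 = - (g *~ k) by apply/eqP; rewrite -addr_eq0 zx.
    have Mk : M (g *~ k, - x2) by have := MN _ Mx; rewrite pairNE x1E opprK.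
    have /(Mfun _ _ _ Mk) <- : M (g *~ k, e' *~ k) by apply: He'; exists (- x2).
    by rewrite subrr.
  - by exists 0, 1; rewrite add0r mulr1z.
have [a Ha] := choice dom.
have aB : {morph a : x y / x - y}.
  move=> x y; apply: (Mfun (x - y)) => //.
  by have := MB _ _ (Ha x) (Ha y); rewrite pairBE.
have [b Hb] := additive_of aB; exists b => u; rewrite Hb.
by apply: (Mfun (i u)) => //; apply: R0M; exists u.
Qed.

(* Here q maps onto E[m]: for m = 0 this is all of E, and for m = p^(n+1) it serves
   homogeneous bounded subgroups, which are summands though not divisible. *)
Lemma injects_into_quotient (P G E : zmodType) (i : {additive P -> G})
    (j q : {additive P -> E}) (m : nat) :
  divisible E -> (forall u, i u = 0 <-> j u = 0) ->
  (forall u, i u = 0 -> q u = 0) ->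
  (forall d, d *+ m = 0 <-> exists u, q u = d) ->
  (forall u g, i u = g *+ m -> i u = 0) ->
  exists N : zmodClosed G,
    (forall x, x \in N <-> exists2 u, q u = 0 & i u = x) /\
    injects_into G {ideal_quot N}.
Proof.
move=> divE kij kiq qE iG.
have sN : is_subgroup (fun x => exists2 u, q u = 0 & i u = x).
  split; first by exists 0; rewrite raddf0.
  move=> _ _ [u qu <-] [v qv <-]; exists (u - v); last by rewrite raddfB.
  by rewrite raddfB qu qv subrr.
pose N := subgroup_of sN; exists N; split; first by move=> x; exact: in_subgroup.
have [p [kp sp]] := quotient_map N.
(* Extending (u, g) |-> j u along (u, g) |-> i u + m g makes [alpha] extend j and kill mG at once,
   so its values lie in E[m]. This is consistent because i(P) meets mG only in 0. *)
have [alpha alphaE] : exists a : {additive G -> E},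
    (forall u, a (i u) = j u) /\ forall g, a g *+ m = 0.
  have i'B : {morph (fun z : P * G => i z.1 + z.2 *+ m) : x y / x - y}.
    by move=> x y /=; rewrite raddfB mulrnBl opprD addrACA.
  have j'B : {morph (fun z : P * G => j z.1) : x y / x - y}.
    by move=> x y /=; rewrite raddfB.
  have [[i' i'E] [j' j'E]] := (additive_of i'B, additive_of j'B).
  have [z|a aE] := additive_extension (i := i') (f := j') divE.
    rewrite i'E j'E => /eqP; rewrite addr_eq0 -mulNrn => /eqP /iG.
    by move/kij.
  exists a; split=> [u|g].
    by have := aE (u, 0); rewrite i'E j'E /= mul0rn addr0.
  by have := aE (0, g); rewrite i'E j'E /= !raddf0 add0r -raddfMn.
have {alphaE} [alphai alpham] := alphaE.
have [u|s sE] := additive_extension (i := j) (f := q) divE; first by move/kij/kiq.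
(* [iota0] identifies E[m] with i(P) / i(ker q) inside G/N by inverting q; its value 0 off E[m] is a
   dummy. *)
have /choice[iota0 iota0E] d : exists t, d *+ m = 0 -> exists2 u, q u = d & t = p (i u).
  have [/qE[u <-]|nd] := pselect (d *+ m = 0); last by exists 0.
  by exists (p (i u)) => _; exists u.
have iotaE u : iota0 (q u) = p (i u).
  have /iota0E[v qv ->] : q u *+ m = 0 by apply/qE; exists u.
  apply/eqP; rewrite -subr_eq0 -!raddfB; apply/eqP/kp/in_subgroup.
  by exists (v - u) => //; rewrite raddfB qv subrr.
have kiota u : iota0 (q u) = 0 -> q u = 0.
  rewrite iotaE => /kp /in_subgroup [v qv iv].
  have : q (u - v) = 0 by apply: kiq; rewrite raddfB iv subrr.
  by rewrite raddfB qv subr0.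
have iotaB d e : d *+ m = 0 -> e *+ m = 0 -> iota0 (d - e) = iota0 d - iota0 e.
  by move=> /qE[u <-] /qE[v <-]; rewrite -raddfB !iotaE -!raddfB.
have sm g : s (alpha g) *+ m = 0 by rewrite -raddfMn alpham raddf0.
pose phi x := iota0 (alpha x) + p x - iota0 (s (alpha x)).
have phiB : {morph phi : x y / x - y}.
  move=> x y; rewrite /phi !raddfB !iotaB //.
  rewrite addrACA -opprD [- (iota0 (s _) - _)]opprD.
  by rewrite [LHS]addrACA -opprD.
have [f fE] := additive_of phiB; exists f.
apply: raddf_inj => x; rewrite fE => phi0.
have /qE[v qv] := alpham x; have /qE[w qw] := sm x.
(* If phi x = 0, then x lies in i(P) + N = i(P). For x = i u the terms p x and iota0 (s (alpha x))
   cancel, leaving iota0 (j u) = 0, hence j u = 0 and x = 0. *)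
have px : p x = p (i (w - v)).
  move: phi0; rewrite /phi -qw -qv !iotaE => /eqP.
  by rewrite subr_eq0 addrC => /eqP pE; rewrite 2!raddfB -pE addrK.
have [u xE] : exists u, x = i u.
  have /kp/in_subgroup[t _ it] : p (x - i (w - v)) = 0 by rewrite [LHS]raddfB -px subrr.
  by exists (t + (w - v)); rewrite raddfD it subrK.
have : iota0 (alpha x) = 0.
  move: phi0; rewrite /phi xE alphai sE iotaE => <-.
  by rewrite addrK.
by rewrite -qv => /kiota; rewrite qv xE alphai => /kij.
Qed.

(** * The kernel of G -> G/N when G embeds in G/N *)

Definition annihilated (G : zmodType) (n : nat) : set G :=
  [set x | x *+ n = 0]%classic.
Arguments annihilated : clear implicits.

Definition torsion_element (G : zmodType) (x : G) : Prop :=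
  exists2 n, (0 < n)%N & x *+ n = 0.

(* Homomorphic images of rat are divisible, and conversely, by extension from int. *)
Definition torsion_divisible (G : zmodType) (x : G) : Prop :=
  torsion_element x /\ exists h : {additive rat -> G}, h 1 = x.

(** [{poly int}] serves as the free Abelian group of countable rank, with the powers of X as
    basis. *)
Definition no_infinite_free_rank (G : zmodType) : Prop :=
  forall h : {additive {poly int} -> G}, ~ injective h.

(** * Torsion elements and finite annihilators *)

Lemma coprime_split (a b : nat) : coprime a b ->
  exists u v : int, forall (G : zmodType) (x : G), x = x *+ a *~ u + x *+ b *~ v.
Proof.
move=> cab; have /coprimezP[[u v] /= uv] : coprimez a b by [].
exists u, v => G x; rewrite !pmulrn -!mulrzA -mulrzDr.
by rewrite [_ + _](_ : _ = 1) ?mulr1z // -uv mulrC [b%:Z * v]mulrC.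
Qed.

Lemma annihilated_coprime (G : zmodType) (a b : nat) (x : G) :
  coprime a b -> x *+ a = 0 -> x *+ b = 0 -> x = 0.
Proof.
by move=> /coprime_split[u [v xE]] xa xb; rewrite (xE _ x) xa xb !mul0rz addr0.
Qed.

Lemma prime_mul_ind (P : nat -> Prop) :
  P 1%N -> (forall n p, prime p -> (0 < n)%N -> P n -> P (n * p)%N) ->
  forall n, (0 < n)%N -> P n.
Proof.
move=> P1 PM n; elim/ltn_ind: n => n IHn n0.
have [n1|n1] := leqP n 1%N; first by have -> : n = 1%N by case: n n0 n1 {IHn} => [|[]].
have pp := pdiv_prime n1; have /dvdnP[q nE] := pdiv_dvd n.
move: (pdiv n) nE pp => p nE pp; rewrite nE.
have q0 : (0 < q)%N by move: n0; rewrite nE muln_gt0 => /andP[].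
apply: PM => //; apply: IHn => //.
by rewrite nE -{1}[q]muln1 ltn_pmul2l // prime_gt1.
Qed.

Lemma torsion_prime_multiple (G : zmodType) (x : G) :
  x <> 0 -> torsion_element x ->
  exists p k, [/\ prime p, x *+ k <> 0 & x *+ k *+ p = 0].
Proof.
move=> xn0 [n n0]; elim/prime_mul_ind: n / n0 => [/xn0 //|n p pp _ IHn xnp].
have [/IHn //|xn] := pselect (x *+ n = 0).
by exists p, n; split=> //; rewrite -mulrnA.
Qed.

Lemma common_annihilator (G : zmodType) (s : seq G) :
  (forall x, x \in s -> torsion_element x) ->
  exists2 n, (0 < n)%N & forall x, x \in s -> x *+ n = 0.
Proof.
elim: s => [|x s IHs] sP; first by exists 1%N.
have [y ys|n n0 nP] := IHs; first by apply: sP; rewrite inE ys orbT.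
have [m m0 xm] := sP x (mem_head _ _).
exists (m * n)%N => [|y]; first by rewrite muln_gt0 m0.
rewrite inE => /orP[/eqP ->|/nP yn]; first by rewrite mulrnA xm mul0rn.
by rewrite mulnC mulrnA yn mul0rn.
Qed.

Lemma poly_additive (G : zmodType) (y : nat -> G) :
  exists h : {additive {poly int} -> G},
    forall (f : {poly int}) n, (size f <= n)%N -> h f = \sum_(k < n) y k *~ f`_k.
Proof.
have sumE (f : {poly int}) n : (size f <= n)%N ->
    \sum_(k < size f) y k *~ f`_k = \sum_(k < n) y k *~ f`_k.
  move=> fn; rewrite (big_ord_widen _ (fun k => y k *~ f`_k) fn) big_mkcond /=.
  apply: eq_bigr => k _; case: ltnP => // fk.
  by rewrite nth_default // mulr0z.
have hB : {morph (fun f : {poly int} => \sum_(k < size f) y k *~ f`_k) : f g / f - g}.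
  move=> f g /=; set n := maxn (size f) (size g).
  have fgn : (size (f - g)%R <= n)%N by rewrite (leq_trans (size_polyD _ _)) // size_polyN.
  rewrite (sumE _ n fgn) (sumE f n) ?leq_maxl // (sumE g n) ?leq_maxr //.
  by rewrite -sumrB; apply: eq_bigr => k _; rewrite coefB mulrzBr.
by have [h hE] := additive_of hB; exists h => f n /sumE fn; rewrite hE.
Qed.

(** Multiplication by a sends G[ab] into G[b] with fibres that are cosets of G[a]; [c] picks a point
    in each fibre. The explicit lists keep the bound |g||h| available for counting. *)
Lemma annihilated_cover (G : zmodType) (a b : nat) (g h : seq G) :
  (forall x, x *+ a = 0 -> x \in g) -> (forall x, x *+ b = 0 -> x \in h) ->
  exists c : G -> G,
    forall x, x *+ (a * b) = 0 -> x \in [seq c t + y | t <- h, y <- g].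
Proof.
move=> gP hP.
have /choice[c cE] (t : G) : exists z, (exists y, y *+ a = t) -> z *+ a = t.
  by have [[y yt]|ny] := pselect (exists y, y *+ a = t); [exists y|exists 0].
exists c => x; rewrite mulrnA => /hP xh.
rewrite -[x](subrK (c (x *+ a))) addrC; apply: allpairs_f => //; apply: gP.
by rewrite mulrnBl cE ?subrr //; exists x.
Qed.

Lemma finite_annihilated_mul (G : zmodType) (a b : nat) :
  finite_set (annihilated G a) -> finite_set (annihilated G b) ->
  finite_set (annihilated G (a * b)).
Proof.
move=> /finite_seqP[g gE] /finite_seqP[h hE].
have gP x : x *+ a = 0 -> x \in g.
  by move=> xa; have : annihilated G a x by []; rewrite gE.
have hP x : x *+ b = 0 -> x \in h.
  by move=> xb; have : annihilated G b x by []; rewrite hE.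
have [c cP] := annihilated_cover gP hP.
apply: (@sub_finite_set _ _ [set` [seq c t + y | t <- h, y <- g]]) => //.
Qed.

Lemma finite_annihilated1 (G : zmodType) : finite_set (annihilated G 1).
Proof. exact: (sub_finite_set (B := [set 0]%classic)). Qed.

Lemma finite_annihilated_exp (G : zmodType) (a e : nat) :
  finite_set (annihilated G a) -> finite_set (annihilated G (a ^ e)).
Proof.
move=> fina; elim: e => [|e IHe]; first exact: finite_annihilated1.
by rewrite expnS; apply: finite_annihilated_mul.
Qed.

Lemma finite_annihilated (G : zmodType) :
  (forall p, prime p -> finite_set (annihilated G p)) ->
  forall n, (0 < n)%N -> finite_set (annihilated G n).
Proof.
move=> finG; apply: prime_mul_ind => [|n p pp _ finn].
  exact: finite_annihilated1.
by apply: finite_annihilated_mul => //; exact: finG.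
Qed.

(** The sets of elements of G[n] lying in n^k M decrease inside a finite set, so they are constant
    from some e on. Induction on the power of n killing n^e x then gives n^e M = n^(e+1) M, and
    iteration the rest. *)
Lemma stable_multiples (G : zmodType) (M : zmodClosed G) (n : nat) :
  finite_set (annihilated G n) ->
  (forall x, x \in M -> exists k, x *+ n ^ k = 0) ->
  exists e, forall k x, x \in M ->
    exists2 y, y \in M & x *+ n ^ e = y *+ n ^ (e + k).
Proof.
move=> /finite_seqP[s sE] torM.
pose S k z := exists2 y, y \in M & z = y *+ n ^ k.
have Santi k l z : (k <= l)%N -> S l z -> S k z.
  move=> kl [y yM ->]; exists (y *+ n ^ (l - k)); first exact: rpredMn.
  by rewrite -mulrnA -expnD subnK.
have [e eP] : exists e, forall z, z \in s -> S e z -> forall k, S k z.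
  elim: s {sE} => [|z s [e eP]]; first by exists 0%N.
  have [Sz|/existsNP[l nSl]] := pselect (forall k, S k z).
    by exists e => w; rewrite inE => /orP[/eqP -> //|/eP].
  exists (maxn e l) => w; rewrite inE => /orP[/eqP -> |ws] Sw.
    by case: nSl; apply: Santi Sw; rewrite leq_maxr.
  by apply: eP => //; apply: Santi Sw; rewrite leq_maxl.
have step m x : x \in M -> x *+ n ^ e *+ n ^ m = 0 ->
    exists2 y, y \in M & x *+ n ^ e = y *+ n ^ e.+1.
  elim: m x => [|m IHm] x xM.
    by rewrite mulr1n => ->; exists 0; rewrite ?rpred0 ?mul0rn.
  rewrite expnSr mulrnA => xnn.
  have /eP/(_ _ (e.+1 + m)%N)[|y yM yE] : x *+ n ^ e *+ n ^ m \in s.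
  - by have : annihilated G n (x *+ n ^ e *+ n ^ m) by []; rewrite sE.
  - by exists (x *+ n ^ m); rewrite ?rpredMn // -!mulrnA mulnC.
  have [||z zM zE] := IHm (x - y *+ n).
  - by rewrite rpredB ?rpredMn.
  - rewrite !mulrnBl yE; apply/eqP; rewrite subr_eq0 -!mulrnA.
    by apply/eqP; congr (_ *+ _); rewrite expnD expnS mulnA.
  exists (z + y); first exact: rpredD.
  by rewrite mulrnDl -zE mulrnBl -mulrnA -expnS subrK.
exists e; elim=> [|k IHk] x xM; first by exists x; rewrite ?addn0.
have [y yM ->] := IHk x xM; have [m ym] := torM y yM.
have [|z zM zE] := step m y yM; first by rewrite -mulrnA mulnC mulrnA ym mul0rn.
exists z => //; rewrite expnD mulrnA zE -mulrnA -expnD.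
by rewrite addnS addSn.
Qed.

Lemma in_divisible_torsion (G : zmodType) (D : zmodClosed G) :
  divisible_subgroup D -> (forall x, x \in D -> torsion_element x) ->
  forall x, x \in D -> torsion_divisible x.
Proof.
move=> divD torD x xD; split; first exact: torD.
have divE : divisible (subgroup_type D).
  move=> n [y yD] n0; have [z zD zy] := divD n y n0 yD.
  by exists (SubgroupElt zD); apply: val_inj; rewrite raddfMn.
pose x' := SubgroupElt xD.
have fB : {morph (fun k : int => x' *~ k) : a b / a - b}.
  by move=> a b; exact: mulrzBr.
have [f fE] := additive_of fB.
have [u /eqP|h hE] := additive_extension (i := intr : {additive int -> rat}) (f := f) divE.
  by rewrite intr_eq0 => /eqP ->; rewrite raddf0.
exists (val \o h : {additive rat -> G}) => /=.
by have := hE 1; rewrite fE mulr1z => ->.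
Qed.

(** To divide by m in l^e T, the l-part of m is absorbed by l^e T = l^(e+k) T, and the part prime to
    l is invertible on an l-primary group by Bezout. *)
Lemma primary_multiples_divisible (G : zmodType) (T : zmodClosed G) (l e : nat) :
  prime l -> (forall x, x \in T -> exists k, x *+ l ^ k = 0) ->
  (forall k x, x \in T ->
    exists2 y, y \in T & x *+ l ^ e = y *+ l ^ (e + k)) ->
  forall x, x \in T -> torsion_divisible (x *+ l ^ e).
Proof.
move=> pl torT eP x xT.
have sD : is_subgroup (fun w => exists2 y, y \in T & w = y *+ l ^ e).
  split; first by exists 0; rewrite ?rpred0 ?mul0rn.
  move=> _ _ [y yT ->] [z zT ->]; exists (y - z); first exact: rpredB.
  by rewrite mulrnBl.
apply: (@in_divisible_torsion G (subgroup_of sD)).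
- move=> m _ m0 /in_subgroup[y yT ->].
  have [y1 y1T ->] := eP (logn l m) y yT.
  have [b y1b] := torT _ y1T.
  have cop : coprime m`_l^' (l ^ b).
    by rewrite coprime_sym coprimeXl // prime_coprime // -p'natE // part_pnat.
  have [u [v uv]] := coprime_split cop.
  exists (y1 *~ u *+ l ^ e); first by apply/in_subgroup; exists (y1 *~ u); rewrite ?rpredMz.
  rewrite {2}(uv _ y1) y1b mul0rz addr0 -{1}(partnC l m0) p_part.
  by rewrite expnD -!mulrnA !pmulrn -!mulrzA; congr (_ *~ _); ring.
- move=> _ /in_subgroup[y yT ->]; have [k yk] := torT _ yT.
  exists (l ^ k)%N; first by rewrite expn_gt0 prime_gt0.
  by rewrite -mulrnA mulnC mulrnA yk mul0rn.
- by apply/in_subgroup; exists x.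
Qed.

(* With z_(k+1) a lift of f z_k, a relation among the z_k reduces modulo ker p to the
   shifted relation by injectivity of f, so all coefficients vanish. *)
Lemma kernel_torsion (G Q : zmodType) (p f : {additive G -> Q}) :
  (forall y, exists x, p x = y) -> injective f -> no_infinite_free_rank G ->
  forall x, p x = 0 -> torsion_element x.
Proof.
move=> sp inj_f nf x px; apply: contrapT => ntx.
have /choice[F FE] : forall z, exists y, p y = f z by move=> z; exact: sp.
pose z k := iter k F x.
have free n : forall a : nat -> int, \sum_(k < n) z k *~ a k = 0 ->
    forall k, (k < n)%N -> a k = 0.
  elim: n => // n IHn a; rewrite big_ord_recl /= => ae.
  have a'0 k : (k < n)%N -> a k.+1 = 0.
    apply: (IHn (fun k => a k.+1)); apply: inj_f; rewrite raddf0.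
    have := congr1 p ae; rewrite raddf0 raddfD raddfMz px mul0rz add0r => <-.
    by rewrite !raddf_sum; apply: eq_bigr => i _; rewrite !raddfMz -FE.
  move: ae; rewrite big1 => [|i _]; last by rewrite a'0 ?mulr0z.
  rewrite addr0 => xa [_|k]; last exact: a'0.
  apply: contrapT => a0; apply: ntx; exists `|a 0%N|%N.
    by rewrite absz_gt0; apply/eqP.
  case: (a 0%N) xa {a0} => m; first by rewrite -pmulrn.
  by rewrite NegzE mulrNz -pmulrn => /eqP; rewrite oppr_eq0 => /eqP.
have [h hE] := poly_additive z; apply: (nf h); apply: raddf_inj => g.
rewrite (hE _ _ (leqnn _)) => /free g0; apply/polyP => k; rewrite coef0.
by have [/g0|/(nth_default 0)] := ltnP k (size g).
Qed.

(* The l-primary part of G is G[l^e], which is finite; a lift of f restricted to it is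
   injective, hence onto, while it can meet ker p only once. *)
Lemma kernel_prime_part (G Q : zmodType) (p f : {additive G -> Q}) l :
  (forall y, exists x, p x = y) -> injective f -> prime l ->
  finite_set (annihilated G l) ->
  (forall x : G, torsion_divisible x -> x *+ l = 0 -> x = 0) ->
  (forall x, p x = 0 -> torsion_element x) ->
  forall x, p x = 0 -> x *+ l = 0 -> x = 0.
Proof.
move=> sp inj_f pl finl redl torN x px xl.
have sT : is_subgroup (fun z : G => exists k, z *+ l ^ k = 0).
  split; first by exists 0%N; rewrite mul0rn.
  move=> z w [k zk] [m wm]; exists (k + m)%N.
  by rewrite expnD mulrnBl mulrnA zk mul0rn mulnC mulrnA wm mul0rn subrr.
pose T := subgroup_of sT.
have [z|e eP] := @stable_multiples G T l finl; first by move/in_subgroup.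
(* By stability l^e T consists of divisible torsion elements. A nonzero one would have a multiple of
   order l, which [redl] excludes. *)
have kill (z : G) : (exists k, z *+ l ^ k = 0) -> z *+ l ^ e = 0.
  move=> zT; apply: contrapT => zn0.
  have [|q [k [pq zk zkq]]] := torsion_prime_multiple zn0.
    have [m zm] := zT; exists (l ^ m)%N; first by rewrite expn_gt0 prime_gt0.
    by rewrite -mulrnA mulnC mulrnA zm mul0rn.
  have ql : q = l.
    have [m zm] := zT; apply: contrapT => /eqP ql; apply: zk.
    apply: (@annihilated_coprime _ q (l ^ m)) => //.
      by rewrite coprime_sym coprimeXl // prime_coprime // dvdn_prime2 // eq_sym.
    by rewrite -!mulrnA mulnA mulnC mulrnA zm mul0rn.
  apply: zk; apply: redl; last by rewrite -{2}ql.
  rewrite -mulrnA mulnC mulrnA.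
  apply: (primary_multiples_divisible pl _ eP); first by move=> w /in_subgroup.
  by have [m zm] := zT; apply/in_subgroup; exists m; rewrite -mulrnA mulnC mulrnA zm mul0rn.
have finT := finite_annihilated_exp e finl.
(* For any lift y of f z, l^e y lies in ker p and is killed by some r > 0. Multiplying y by a number
   that is 1 modulo l^e and 0 modulo the l'-part of r keeps the image f z and makes y l-primary. *)
have /choice[F FE] z : exists y, z *+ l ^ e = 0 -> p y = f z /\ y *+ l ^ e = 0.
  have [zl|] := pselect (z *+ l ^ e = 0); last by exists 0.
  have [y yE] := sp (f z).
  have [|r r0 yr] := torN (y *+ l ^ e); first by rewrite raddfMn yE -raddfMn zl raddf0.
  have cop : coprime r`_l^' (l ^ e).
    by rewrite coprime_sym coprimeXl // prime_coprime // -p'natE // part_pnat.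
  have [u [v uv]] := coprime_split cop.
  exists (y *+ r`_l^' *~ u) => _; split.
    by rewrite -yE {2}(uv _ y) raddfD [p (_ *~ v)]raddfMz raddfMn yE -raddfMn zl raddf0 mul0rz addr0.
  apply: kill; exists (logn l r + e)%N; rewrite expnD -p_part.
  transitivity (y *+ l ^ e *+ r *~ u); last by rewrite yr mul0rz.
  rewrite -[in RHS](partnC l r0) !pmulrn -!mulrzA; congr (_ *~ _); ring.
have /finite_seqP[s0 sE] := finT; pose s := undup s0.
have sP (z : G) : z \in s <-> z *+ l ^ e = 0.
  by rewrite mem_undup; have -> : (z *+ l ^ e = 0) = annihilated G (l ^ e) z by []; rewrite sE.
have Finj : {in s &, injective F}.
  by move=> a b /sP /FE[Fa _] /sP /FE[Fb _] E; apply: inj_f; rewrite -Fa E.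
have [|||_ sFs] := uniq_min_size (s1 := [seq F z | z <- s]) (s2 := s).
- by rewrite map_inj_in_uniq ?undup_uniq.
- by move=> _ /mapP[z /sP /FE[_ Fz] ->]; apply/sP.
- by rewrite size_map.
have ps z : z \in s -> p z = 0 -> z = F 0.
  rewrite -sFs => /mapP[w ws ->]; have [-> _] := FE w ((sP w).1 ws).
  by rewrite -(raddf0 f) => /inj_f ->.
have <- : F 0 = 0 by apply/esym/ps; rewrite ?raddf0 //; apply/sP; rewrite mul0rn.
by apply: ps => //; apply/sP; apply: kill; exists 1%N; rewrite expn1.
Qed.

(* Since n^e N = n^(e+k) N, f lifts to F : G[n^k] -> G[n^(k+e)] injective modulo N, so
   |G[n^k]| |N[n^k]| <= |G[n^(k+e)]| <= |G[n^k]| |G[n^e]|. *)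
Lemma kernel_primary_finite (G Q : zmodType) (p f : {additive G -> Q}) n :
  (forall y, exists x, p x = y) -> injective f -> (0 < n)%N ->
  (forall k, finite_set (annihilated G (n ^ k))) ->
  (forall x, p x = 0 -> exists k, x *+ n ^ k = 0) ->
  finite_set [set x | p x = 0]%classic.
Proof.
move=> sp inj_f n0 finG torN.
have sN : is_subgroup (fun z : G => p z = 0).
  by split=> [|z w pz pw]; rewrite ?raddf0 // raddfB pz pw subrr.
pose N := subgroup_of sN.
have [||e eP] := @stable_multiples G N n.
- by have := finG 1%N; rewrite expn1.
- by move=> x /in_subgroup /torN.
(* A lift y0 of f x has n^k y0 in N. Stability yields d in N with n^(e+k) d = n^(k+e) y0, and y0 - d
   is still a lift. *)
have lift k x : exists y, x *+ n ^ k = 0 -> p y = f x /\ y *+ n ^ (k + e) = 0.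
  have [xk|] := pselect (x *+ n ^ k = 0); last by exists 0.
  have [y0 y0E] := sp (f x).
  have y0N : y0 *+ n ^ k \in N by apply/in_subgroup; rewrite raddfMn y0E -raddfMn xk raddf0.
  have [d /in_subgroup dN dE] := eP k _ y0N.
  exists (y0 - d) => _; split; first by rewrite raddfB dN subr0.
  by rewrite mulrnBl {1}expnD mulrnA dE addnC subrr.
have /finite_seqP[h hE] := finG e.
apply: contrapT => /(infinite_set_fset (size h).+1)[s sN' ssize].
have sP x : x \in finmap.enum_fset s -> p x = 0 by move=> xs; exact: (sN' x).
have us : uniq (finmap.enum_fset s) by exact: finmap.fset_uniq.
move: (finmap.enum_fset s) ssize sP us => {sN'} {}s ssize sP us.
have [k kP] : exists k, forall x, x \in s -> x *+ n ^ k = 0.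
  elim: s {ssize us} sP => [|x s IHs] sP; first by exists 0%N.
  have [y ys|k kP] := IHs; first by apply: sP; rewrite inE ys orbT.
  have [m xm] := torN x (sP x (mem_head _ _)).
  exists (m + k)%N => y; rewrite inE expnD => /orP[/eqP ->|/kP yk].
    by rewrite mulrnA xm mul0rn.
  by rewrite mulnC mulrnA yk mul0rn.
have /choice[F FE] := lift k.
have /finite_seqP[g0 gE] := finG k; pose g := undup g0.
have gP x : x \in g <-> x *+ n ^ k = 0.
  by rewrite mem_undup; have -> : (x *+ n ^ k = 0) = annihilated G (n ^ k) x by []; rewrite gE.
have [x|x|c cP] := @annihilated_cover G (n ^ k) (n ^ e) g h.
- by move/gP.
- by move=> xe; have : annihilated G (n ^ e) x by []; rewrite hE.
have Fx (x y : G) : x \in g -> y \in s -> p (F x + y) = f x.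
  by move=> /gP /FE[Fx _] /sP py; rewrite raddfD Fx py addr0.
(* The sums F x + y are distinct, because p sends them to f x and f is injective. They lie in
   G[n^(k+e)], so |g||s| <= |h||g|, against the choice of [s] larger than [h]. *)
have : (size [seq (F x + y)%R | x <- g, y <- s] <= size [seq (c t + y)%R | t <- h, y <- g])%N.
  apply: uniq_leq_size.
    apply: allpairs_uniq; rewrite ?undup_uniq //.
    move=> [x y] [x' y'] /allpairsP[[a b] /= [ag bs [-> ->]]].
    move=> /allpairsP[[a' b'] /= [ag' bs' [-> ->]]] /= E.
    have aa' : a = a' by apply: inj_f; rewrite -(Fx a b) // E Fx.
    by move: E; rewrite aa' => /addrI ->.
  move=> _ /allpairsP[[x y] /= [xg ys ->]]; apply: cP.
  have /FE[_ Fk] := (gP x).1 xg.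
  by rewrite mulrnDl -expnD Fk expnD [X in _ + X]mulrnA kP // mul0rn addr0.
rewrite !size_allpairs mulnC leq_pmul2r; last first.
  by rewrite lt0n size_eq0; apply/eqP => g_0; have /gP := mul0rn G (n ^ k); rewrite g_0.
by rewrite leqNgt ssize.
Qed.

(** The union, not the sum, of the D[p] over all primes p: it is finite exactly when every D[p] is
    finite and almost all are 0. *)
Definition divisible_socle (G : zmodType) : set G :=
  [set x | torsion_divisible x /\ exists2 p, prime p & x *+ p = 0]%classic.
Arguments divisible_socle : clear implicits.

Lemma reduced_Bassian (G : zmodType) :
  no_infinite_free_rank G ->
  (forall p, prime p -> finite_set (annihilated G p)) ->
  (forall x : G, torsion_divisible x -> x = 0) -> Bassian G.
Proof.
move=> nf finG red N [f inj_f] x; have [p [kp sp]] := quotient_map N.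
apply/idP/eqP => [xN|->]; last exact: rpred0.
have torN := kernel_torsion sp inj_f nf.
have px := (kp x).2 xN; apply: contrapT => xn0.
have [q [k [pq xk]]] := torsion_prime_multiple xn0 (torN x px).
apply: contra_not xk => xkq.
apply: (kernel_prime_part sp inj_f pq (finG q pq) _ torN _ xkq) => [y /red //|].
by rewrite raddfMn px mul0rn.
Qed.

(** Let n > 0 kill the finite set of elements of prime order in D. If a prime q does not divide n,
    then D[q] = 0, so N has no element of order q. Hence powers of n kill all of N, and a single
    count with n suffices. *)
Lemma finitely_Bassian_of_finite (G : zmodType) :
  no_infinite_free_rank G ->
  (forall p, prime p -> finite_set (annihilated G p)) ->
  finite_set (divisible_socle G) -> finitely_Bassian G.
Proof.
move=> nf finG /finite_seqP[s sE] N [f inj_f].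
have [p [kp sp]] := quotient_map N.
have torN := kernel_torsion sp inj_f nf.
have socP x : divisible_socle G x -> x \in s by rewrite sE.
have sP x : x \in s -> torsion_element x.
  by move=> xs; have [[]] : divisible_socle G x by rewrite sE.
have [n n0 nP] := common_annihilator sP.
have noprime q x : prime q -> ~~ (q %| n)%N -> p x = 0 -> x *+ q = 0 -> x = 0.
  move=> pq qn; apply: (kernel_prime_part sp inj_f pq (finG q pq) _ torN).
  move=> y yD yq; apply: (@annihilated_coprime _ q n) => //.
    by rewrite prime_coprime.
  by apply/nP/socP; split=> //; exists q.
have torn x : p x = 0 -> exists k, x *+ n ^ k = 0.
  move=> px; have [m m0] := torN x px; elim/prime_mul_ind: m / m0 x px => [|m l pl _ IHm] x px xm.
    by exists 0%N.
  have [||k xk] := IHm (x *+ l).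
  - by rewrite raddfMn px mul0rn.
  - by rewrite -mulrnA mulnC.
  have [ln|ln] := boolP (l %| n)%N.
    exists k.+1; have [r nE] := dvdnP ln.
    rewrite expnS {1}nE (mulnC r) -mulnA mulrnA [(r * _)%N]mulnC mulrnA xk.
    exact: mul0rn.
  exists k; apply: (noprime l) => //; first by rewrite raddfMn px mul0rn.
  by rewrite -mulrnA mulnC mulrnA.
apply: (sub_finite_set (B := [set x | p x = 0]%classic)).
  by move=> x /= xN; apply/kp.
apply: (kernel_primary_finite sp inj_f n0) => // k.
by apply: finite_annihilated => //; rewrite expn_gt0 n0.
Qed.

(** * The maximal divisible torsion subgroup *)

Lemma torsion_divisible_subgroup (G : zmodType) :
  is_subgroup (@torsion_divisible G).
Proof.
split.
  split; first by exists 1%N.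
  by exists (\0 : {additive rat -> G}).
move=> x y [[n n0 xn] [h hx]] [[m m0 ym] [g gy]]; split.
  exists (n * m)%N; first by rewrite muln_gt0 n0.
  by rewrite mulrnBl mulrnA xn mul0rn mulnC mulrnA ym mul0rn subrr.
by exists (h \- g : {additive rat -> G}); rewrite /= hx gy.
Qed.

Definition divisible_torsion (G : zmodType) : zmodClosed G :=
  subgroup_of (torsion_divisible_subgroup G).

Lemma divisible_torsion_divisible (G : zmodType) :
  divisible (subgroup_type (divisible_torsion G)).
Proof.
move=> n [x xD] n0; have /in_subgroup[[m m0 xm] [h hx]] := xD.
have n0' : n%:R != 0 :> rat by rewrite pnatr_eq0 -lt0n.
have hn : h (n%:R^-1) *+ n = x.
  by rewrite -raddfMn -[_ *+ _]mulr_natr mulVf.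
have yD : h (n%:R^-1) \in divisible_torsion G.
  apply/in_subgroup; split.
    by exists (n * m)%N; rewrite ?muln_gt0 ?n0 // mulrnA hn.
  have gB : {morph (fun r : rat => h (r / n%:R)) : r s / r - s}.
    by move=> r s; rewrite mulrBl raddfB.
  by have [g gE] := additive_of gB; exists g; rewrite gE mul1r.
by exists (SubgroupElt yD); apply: val_inj; rewrite raddfMn.
Qed.

Lemma Bassian_finitely_Bassian (G : zmodType) : Bassian G -> finitely_Bassian G.
Proof.
move=> BG N /BG N0; apply: (sub_finite_set (B := [set 0]%classic)) => // x /=.
by rewrite N0 => /eqP.
Qed.

Lemma Bassian_reduced (G : zmodType) : Bassian G ->
  forall x : G, torsion_divisible x -> x = 0.
Proof.
move=> BG x xD; apply: contrapT => xn0.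
have [p [k [pp xk xkp]]] := torsion_prime_multiple xn0 xD.1.
pose E := subgroup_type (divisible_torsion G).
have divE : divisible E by exact: divisible_torsion_divisible.
have qB : {morph (fun y : E => y *+ p) : y z / y - z} by move=> y z; exact: mulrnBl.
have [q qE] := additive_of qB.
have [||||N [NP GN]] := @injects_into_quotient E G E val idfun q 0%N divE.
- by move=> u; split=> u0; [exact: val_inj | rewrite [u]u0].
- by move=> u u0; rewrite qE (_ : u = 0) ?mul0rn //; apply: val_inj.
- move=> d; split=> // _; have [u ud] := divE p d (prime_gt0 pp).
  by exists u; rewrite qE.
- by [].
have xkE : x *+ k \in divisible_torsion G by rewrite rpredMn //; apply/in_subgroup.
apply: xk; apply/eqP; have := BG N GN (x *+ k); rewrite inE => <-.
apply/NP; exists (SubgroupElt xkE : E) => //.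
by rewrite qE; apply: val_inj; rewrite raddfMn.
Qed.

Lemma injective_no_infinite_free_rank (G H : zmodType) (f : {additive G -> H}) :
  injective f -> no_infinite_free_rank H -> no_infinite_free_rank G.
Proof. by move=> fi nf h hi; apply: (nf (f \o h)); exact: inj_comp. Qed.

Lemma injective_finite_annihilated (G H : zmodType) (f : {additive G -> H}) n :
  injective f -> finite_set (annihilated H n) -> finite_set (annihilated G n).
Proof.
move=> fi finH; have := @finite_preimage _ _ (annihilated H n) f _ finH.
move/(_ (in2W fi)); apply: sub_finite_set => x /= xn.
by rewrite /annihilated /= -raddfMn xn raddf0.
Qed.

Lemma torsion_divisible_morph (G H : zmodType) (f : {additive G -> H}) x :
  torsion_divisible x -> torsion_divisible (f x).
Proof.
move=> [[n n0 xn] [h hx]]; split.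
  by exists n => //; rewrite -raddfMn xn raddf0.
by exists (f \o h : {additive rat -> H}); rewrite /= hx.
Qed.

Lemma injective_divisible_socle (G H : zmodType) (f : {additive G -> H}) :
  injective f -> finite_set (divisible_socle H) -> finite_set (divisible_socle G).
Proof.
move=> fi finH; have := @finite_preimage _ _ (divisible_socle H) f _ finH.
move/(_ (in2W fi)); apply: sub_finite_set => x /= [xD [p pp xp]]; split.
  exact: torsion_divisible_morph.
by exists p => //; rewrite -raddfMn xp raddf0.
Qed.

(** * Elements of prime order in the divisible part *)

(* The residue modulo o of the profinite integer whose p-component is p for every p:
   multiplication by it is a surjective endomorphism of a divisible torsion group that
   kills all elements of prime order. *)
Definition prime_residue (o c : nat) : Prop :=
  forall p, prime p -> (p %| o)%N -> c = p %[mod p ^ logn p o].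

Lemma prime_residue_exists o : (0 < o)%N -> exists c, prime_residue o c.
Proof.
elim/ltn_ind: o => o IHo o0.
have [o1|o1] := leqP o 1%N.
  exists 0%N => p pp po; have : (p <= 1)%N by rewrite (leq_trans (dvdn_leq o0 po)).
  by rewrite leqNgt prime_gt1.
have pp := pdiv_prime o1; have po := pdiv_dvd o; move: (pdiv o) pp po => p pp po.
have [l0 [m [pm oE]]] : (0 < logn p o)%N /\ exists m, ~~ (p %| m)%N /\ o = (p ^ logn p o * m)%N.
  split; first by rewrite logn_gt0 mem_primes pp o0.
  have [m pm oE] := pfactor_coprime pp o0; exists m.
  by rewrite -prime_coprime // mulnC.
have m0 : (0 < m)%N by move: o0; rewrite oE muln_gt0 => /andP[].
have [|c cP] := IHo m _ m0.
  rewrite oE -{1}[m]mul1n ltn_pmul2r //.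
  by rewrite -(exp1n (logn p o)) ltn_exp2r ?prime_gt1.
have cop : coprime (p ^ logn p o) m by rewrite coprimeXl // prime_coprime.
exists (chinese (p ^ logn p o) m p c) => r pr ro.
have [->|rp] := eqVneq r p; first by rewrite chinese_modl.
have rm : (r %| m)%N.
  by move: ro; rewrite oE Euclid_dvdM // Euclid_dvdX // dvdn_prime2 // (negbTE rp).
have -> : logn r o = logn r m.
  rewrite oE logn_Gauss // prime_coprime // Euclid_dvdX // dvdn_prime2 //.
  by rewrite (negbTE rp).
have dv := pfactor_dvdnn r m.
by rewrite -(modn_dvdm _ dv) chinese_modr // modn_dvdm //; apply: cP.
Qed.

Lemma eqn_mod_prime_powers o a b : (0 < o)%N ->
  (forall p, prime p -> (p %| o)%N -> a = b %[mod p ^ logn p o]) -> a = b %[mod o].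
Proof.
move=> o0; wlog ba : a b / (b <= a)%N => [hw ab|ab].
  have [ba|/ltnW ba] := leqP b a; first exact: hw.
  by apply/esym/hw => // p pp po; apply/esym/ab.
apply/eqP; rewrite eqn_mod_dvd //; apply/dvdn_partP => // p.
rewrite mem_primes => /and3P[pp _ po]; rewrite p_part -eqn_mod_dvd //.
exact/eqP/ab.
Qed.

Lemma prime_residue_eq o o' c c' : (0 < o')%N -> (o %| o')%N ->
  prime_residue o c -> prime_residue o' c' -> c = c' %[mod o].
Proof.
move=> o'0 oo' cP c'P; have o0 := dvdn_gt0 o'0 oo'.
apply: eqn_mod_prime_powers => // p pp po.
rewrite cP //; have po' := dvdn_trans po oo'.
have dv : (p ^ logn p o %| p ^ logn p o')%N by rewrite dvdn_exp2l // dvdn_leq_log.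
by rewrite -(modn_dvdm c' dv) c'P // modn_dvdm.
Qed.

(** A prime p dividing the gcd has exponent at least 2 in [o * o], so c = p modulo p^2 and p divides
    c exactly once. The gcd is thus a product of distinct primes dividing o. *)
Lemma prime_residue_gcd o c : (0 < o)%N -> prime_residue (o * o) c ->
  (gcdn c (o * o) %| o)%N.
Proof.
move=> o0 cP; have oo0 : (0 < o * o)%N by rewrite muln_gt0 o0.
have g0 : (0 < gcdn c (o * o))%N by rewrite gcdn_gt0 oo0 orbT.
apply/dvdn_partP => // p; rewrite mem_primes => /and3P[pp _ pg].
have poo := dvdn_trans pg (dvdn_gcdr _ _).
have po : (p %| o)%N by move: poo; rewrite Euclid_dvdM // orbb.
rewrite p_part; apply: (@dvdn_trans (p ^ 1)%N); last by rewrite expn1.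
apply: dvdn_exp2l; rewrite leqNgt; apply/negP => l2.
have p2g : (p ^ 2 %| gcdn c (o * o))%N by rewrite pfactor_dvdn.
have p2c := dvdn_trans p2g (dvdn_gcdl _ _).
have p2oo := dvdn_trans p2g (dvdn_gcdr _ _).
have dv : (p ^ 2 %| p ^ logn p (o * o))%N by rewrite dvdn_exp2l // -pfactor_dvdn.
have : (p ^ 2 %| p)%N.
  by rewrite /dvdn -(modn_dvdm p dv) -cP // modn_dvdm.
move/dvdn_leq => /(_ (prime_gt0 pp)); rewrite leqNgt.
by rewrite -{1}[p]expn1 ltn_exp2l // prime_gt1.
Qed.

(** The residues define an endomorphism q of D acting as p on each p-component. It is onto and kills
    every element of prime order, so these lie in the subgroup N = ker q, which must be finite. *)
Lemma finite_divisible_socle (G : zmodType) :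
  finitely_Bassian G -> finite_set (divisible_socle G).
Proof.
move=> FG; pose E := subgroup_type (divisible_torsion G).
have divE : divisible E by exact: divisible_torsion_divisible.
have torE (x : E) : exists2 n, (0 < n)%N & x *+ n = 0.
  case: x => x xD; have /in_subgroup[[n n0 xn] _] := xD.
  by exists n => //; apply: val_inj; rewrite raddfMn.
have modE (x : E) o a b : x *+ o = 0 -> a = b %[mod o] -> x *+ a = x *+ b.
  move=> xo ab; rewrite (divn_eq a o) (divn_eq b o) ab !mulrnDr.
  by rewrite ![(_ * o)%N]mulnC !mulrnA xo !mul0rn.
(* Residues for two annihilators n and o of x both agree with one for n * o, so the value depends on
   neither the annihilator nor the residue. *)
have /choice[Q QE] (x : E) : exists y, forall o c, (0 < o)%N -> x *+ o = 0 ->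
    prime_residue o c -> y = x *+ c.
  have [n n0 xn] := torE x; have [c cP] := prime_residue_exists n0.
  exists (x *+ c) => o d o0 xo dP.
  have no0 : (0 < n * o)%N by rewrite muln_gt0 n0.
  have [e eP] := prime_residue_exists no0.
  rewrite (modE x n c e) //; last by apply: prime_residue_eq cP eP => //; apply: dvdn_mulr.
  apply/esym; apply: (modE x o) => //.
  by apply: prime_residue_eq dP eP => //; apply: dvdn_mull.
have QB : {morph Q : x y / x - y}.
  move=> x y; have [[n n0 xn] [m m0 ym]] := (torE x, torE y).
  have nm0 : (0 < n * m)%N by rewrite muln_gt0 n0.
  have [c cP] := prime_residue_exists nm0.
  have xnm : x *+ (n * m) = 0 by rewrite mulrnA xn mul0rn.
  have ynm : y *+ (n * m) = 0 by rewrite mulnC mulrnA ym mul0rn.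
  rewrite (QE x _ _ nm0 xnm cP) (QE y _ _ nm0 ynm cP) (QE (x - y) _ _ nm0 _ cP).
    by rewrite mulrnBl.
  by rewrite mulrnBl xnm ynm subrr.
have [q qE] := additive_of QB.
(* Write y = g z with g = gcd(c, o^2). As g divides o, z is killed by o^2, so q multiplies z by c;
   with g = u c + v o^2, the element u z is a preimage of y. *)
have Qsurj y : exists x, q x = y.
  have [o o0 yo] := torE y; have oo0 : (0 < o * o)%N by rewrite muln_gt0 o0.
  have [c cP] := prime_residue_exists oo0.
  have g0 : (0 < gcdn c (o * o))%N by rewrite gcdn_gt0 oo0 orbT.
  have [z zy] := divE _ y g0.
  have zoo : z *+ (o * o) = 0.
    have [k oE] := dvdnP (prime_residue_gcd o0 cP).
    by rewrite {2}oE mulnA [(_ * gcdn _ _)%N]mulnC mulrnA zy mulrnA yo mul0rn.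
  have [u [v uv]] := Bezoutz c (o * o)%N.
  exists (z *~ u); rewrite qE (QE _ _ _ oo0 _ cP).
    rewrite -zy; apply/esym; rewrite pmulrn [gcdn _ _ : int](_ : _ = gcdz c (o * o)%N) // -uv.
    rewrite mulrzDr [v * _]mulrC [z *~ (_ * v)]mulrzA -pmulrn zoo mul0rz addr0.
    by rewrite mulrzA -pmulrn.
  by rewrite pmulrn -mulrzA mulrC mulrzA -pmulrn zoo mul0rz.
have [||||N [NP GN]] := @injects_into_quotient E G E val idfun q 0%N divE.
- by move=> u; split=> u0; [exact: val_inj | rewrite [u]u0].
- by move=> u u0; rewrite (_ : u = 0) ?raddf0 //; apply: val_inj.
- by move=> d; split=> // _; have [u ud] := Qsurj d; exists u.
- by [].
apply: sub_finite_set (FG N GN) => x [xD [p pp xp]] /=; apply/NP.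
have xD' : x \in divisible_torsion G by apply/in_subgroup.
have p0 := prime_gt0 pp; have [c cP] := prime_residue_exists p0.
have xp' : (SubgroupElt xD' : E) *+ p = 0 by apply: val_inj; rewrite raddfMn.
exists (SubgroupElt xD' : E) => //; rewrite qE (QE _ _ _ p0 xp' cP).
have := cP p pp (dvdnn p); rewrite -{3}[p]expn1 pfactorK // expn1 modnn => /eqP /dvdnP[k ->].
by rewrite mulnC mulrnA xp' mul0rn.
Qed.

(** * Independent sequences *)

(** The y_k generate a direct sum of the cyclic groups Z/o(k). Order 0 encodes infinite order, since
    0 divides only 0. *)
Definition independent_of_orders (G : zmodType) (o : nat -> nat) (y : nat -> G) :=
  (forall k, y k *+ o k = 0) /\
  forall n (a : nat -> int), \sum_(k < n) y k *~ a k = 0 ->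
    forall k, (k < n)%N -> (o k %| a k)%Z.

(** The kernel depends on the orders alone, so independent sequences of equal orders in two groups
    give maps with the same kernel. *)
Lemma independent_kernel (G : zmodType) o (y : nat -> G)
    (h : {additive {poly int} -> G}) :
  (forall (f : {poly int}) n, (size f <= n)%N -> h f = \sum_(k < n) y k *~ f`_k) ->
  independent_of_orders o y ->
  forall f : {poly int}, h f = 0 <-> forall k, (o k %| f`_k)%Z.
Proof.
move=> hE [yo yind] f; rewrite (hE f _ (leqnn _)); split=> [/yind f0 k|fo].
  by have [/f0|/(nth_default 0) ->] := ltnP k (size f).
rewrite big1 // => k _; have /dvdzP[c ->] := fo k.
by rewrite mulrC mulrzA -pmulrn yo mul0rz.
Qed.

Lemma infinite_of_injective (T : Type) (A : set T) (g : nat -> T) :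
  injective g -> (forall l, A (g l)) -> ~ finite_set A.
Proof.
move=> gi gA /(finite_preimage (in2W gi)) finN; apply: infinite_nat.
by apply: sub_finite_set finN => l _; exact: gA.
Qed.

(** The embedding into a quotient is applied with P = [{poly int}], where i, j and q send the k-th
    power of X to y_k, e_k and c_k. Since c vanishes along s, N contains all y_(s l), which are
    distinct because no order is 1. *)
Lemma finitely_Bassian_no_sequence (G E : zmodType) (m : nat) (o : nat -> nat)
    (y : nat -> G) (e c : nat -> E) (s : nat -> nat) :
  finitely_Bassian G -> divisible E -> (forall k, o k != 1%N) ->
  independent_of_orders o y -> independent_of_orders o e ->
  (forall k, c k *+ o k = 0) -> (forall k, c k *+ m = 0) ->
  (forall d, d *+ m = 0 -> exists k, c k = d) ->
  injective s -> (forall l, c (s l) = 0) ->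
  (forall n (a : nat -> int) g, \sum_(k < n) y k *~ a k = g *+ m ->
    \sum_(k < n) y k *~ a k = 0) -> False.
Proof.
move=> FG divE o1 yind eind co cm csurj si cs yG.
have [i iE] := poly_additive y; have [j jE] := poly_additive e.
have [q qE] := poly_additive c.
have ki := independent_kernel iE yind; have kj := independent_kernel jE eind.
have iX k : i 'X^k = y k.
  rewrite (iE _ k.+1) ?size_polyXn // big_ord_recr /= coefXn eqxx mulr1z.
  by rewrite big1 ?add0r // => l _; rewrite coefXn ltn_eqF // mulr0z.
have qX k : q 'X^k = c k.
  rewrite (qE _ k.+1) ?size_polyXn // big_ord_recr /= coefXn eqxx mulr1z.
  by rewrite big1 ?add0r // => l _; rewrite coefXn ltn_eqF // mulr0z.
have [|||u g|N [NP GN]] := @injects_into_quotient _ G E i j q m divE.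
- by move=> u; rewrite ki kj.
- move=> u /ki uo; rewrite (qE u _ (leqnn _)) big1 // => k _.
  have /dvdzP[b ->] := uo k.
  by rewrite mulrC mulrzA -pmulrn co mul0rz.
- move=> d; split=> [/csurj[k <-]|[u <-]]; first by exists 'X^k.
  rewrite (qE u _ (leqnn _)) -sumrMnl big1 // => k _.
  by rewrite pmulrn -mulrzA mulrC mulrzA -pmulrn cm mul0rz.
- by rewrite (iE u _ (leqnn _)); apply: yG.
apply: (@infinite_of_injective _ [set` N] (y \o s)) (FG N GN) => [k l /= ykl|l /=].
  apply: si; apply: contrapT => /eqP kl.
  have /ki /(_ (s k)) : i ('X^(s k) - 'X^(s l)) = 0 by rewrite raddfB !iX ykl subrr.
  rewrite coefB !coefXn eqxx (negbTE kl) subr0 dvdz1 /=.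
  by rewrite (negbTE (o1 _)).
by apply/NP; exists 'X^(s l); rewrite ?iX // qX cs.
Qed.

(* Every polynomial is the first component of [code k] for infinitely many k, once for
   each value of the second component. *)
Definition code (k : nat) : {poly rat} * nat := odflt (0, 0%N) (unpickle k).

Lemma codeK d : code (pickle d) = d.
Proof. by rewrite /code pickleK. Qed.

Lemma divisible_poly_rat : divisible {poly rat}.
Proof.
move=> n f n0; exists (n%:R^-1 *: f).
by rewrite -scaler_nat scalerA mulfV ?scale1r // pnatr_eq0 -lt0n.
Qed.

Lemma finitely_Bassian_no_free (G : zmodType) :
  finitely_Bassian G -> no_infinite_free_rank G.
Proof.
move=> FG h hi.
pose s (l : nat) := pickle (0 : {poly rat}, l).
have si : injective s by move=> k l /(pcan_inj pickleK) [].
apply: (@finitely_Bassian_no_sequence G {poly rat} 0 (fun=> 0%N) (fun k => h 'X^k)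
  (fun k => 'X^k) (fun k => (code k).1) s) => //.
- exact: divisible_poly_rat.
- split=> // n a; have -> : \sum_(k < n) h 'X^k *~ a k = h (\sum_(k < n) 'X^k *~ a k).
    by rewrite raddf_sum; apply: eq_bigr => k _; rewrite raddfMz.
  rewrite -(raddf0 h) => /hi sum0 k kn; rewrite dvd0z; apply/eqP.
  have := congr1 (fun f : {poly int} => f`_k) sum0.
  rewrite coef_sum (bigD1 (Ordinal kn)) //= coefMrz coefXn eqxx intz big1 ?addr0 ?coef0 //.
  move=> l lk; rewrite coefMrz coefXn (_ : (k == l) = false) ?mul0rz //.
  by apply/negbTE; move: lk; rewrite -val_eqE eq_sym.
- split=> // n a sum0 k kn; rewrite dvd0z.
  have := congr1 (fun f : {poly rat} => f`_k) sum0.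
  rewrite coef_sum (bigD1 (Ordinal kn)) //= coefMrz coefXn eqxx big1 ?addr0 ?coef0.
    by move/eqP; rewrite intr_eq0.
  move=> l lk; rewrite coefMrz coefXn (_ : (k == l) = false) ?mul0rz //.
  by apply/negbTE; move: lk; rewrite -val_eqE eq_sym.
- by move=> d _; exists (pickle (d, 0%N)); rewrite codeK.
- by move=> l; rewrite codeK.
Qed.

(* {poly rat} modulo these polynomials is a countable direct sum of copies of Z(p^oo). *)
Definition locally_integral (p : nat) (f : {poly rat}) : Prop :=
  exists2 n, ~~ (p %| n)%N & exists g : {poly int}, f *+ n = map_poly intr g.

Lemma locally_integral_subgroup p : prime p -> is_subgroup (locally_integral p).
Proof.
move=> pp; split.
  exists 1%N; first by rewrite dvdn1; apply: contraL pp => /eqP ->.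
  by exists 0; rewrite map_poly0.
move=> f g [n pn [u uE]] [m pm [v vE]]; exists (n * m)%N.
  by rewrite Euclid_dvdM // negb_or pn.
exists (u *+ m - v *+ n); rewrite mulrnBl mulrnA uE mulnC mulrnA vE.
by rewrite raddfB !raddfMn.
Qed.

Lemma common_denominator (f : {poly rat}) :
  exists2 n, (0 < n)%N & exists g : {poly int}, f *+ n = map_poly intr g.
Proof.
have [q [a a0 fE]] := rat_poly_scale f.
have fa : f *~ a = map_poly intr q.
  by rewrite fE -scaler_int scalerA mulfV ?scale1r // intr_eq0.
exists `|a|%N; first by rewrite absz_gt0.
case: a a0 fa {fE} => n _ fa; first by exists q.
by exists (- q); rewrite raddfN /= -fa NegzE mulrNz opprK.
Qed.

(** The elements of prescribed orders are the classes of X^k / p^(a k + 1), one coordinate for each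
    k. The map [pi] lets [code] enumerate E through polynomials. *)
Lemma primary_divisible_group p : prime p ->
  exists (E : zmodType) (pi : {additive {poly rat} -> E}),
    [/\ divisible E, forall d, exists f, pi f = d,
        forall d : E, exists k, d *+ p ^ k = 0 &
        forall a : nat -> nat, exists e : nat -> E,
          independent_of_orders (fun k => p ^ (a k).+1)%N e].
Proof.
move=> pp; have sL := locally_integral_subgroup pp.
have [pi [kpi spi]] := quotient_map (subgroup_of sL).
exists {ideal_quot subgroup_of sL}, pi; split=> //.
- move=> n d n0; have [f <-] := spi d; have [g <-] := divisible_poly_rat f n0.
  by exists (pi g); rewrite raddfMn.
- move=> d; have [f <-] := spi d; have [n n0 [g gE]] := common_denominator f.
  have [m pm nE] := pfactor_coprime pp n0; exists (logn p n).
  rewrite -raddfMn; apply/kpi/in_subgroup; exists m; first by rewrite -prime_coprime.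
  by exists g; rewrite -mulrnA mulnC -nE.
move=> a; pose o k := (p ^ (a k).+1)%N.
have o0 k : (o k)%:R != 0 :> rat by rewrite pnatr_eq0 -lt0n expn_gt0 prime_gt0.
exists (fun k => pi ((o k)%:R^-1 *: 'X^k)); split.
  move=> k; rewrite -raddfMn -scaler_nat scalerA mulfV ?scale1r; last exact: o0.
  apply/kpi/in_subgroup; exists 1%N; first by rewrite dvdn1; apply: contraL pp => /eqP ->.
  by exists 'X^k; rewrite map_polyXn.
move=> n b sum0 k kn.
have /kpi/in_subgroup[m pm [g gE]] :
    pi (\sum_(l < n) ((o l)%:R^-1 *: 'X^l) *~ b l) = 0.
  by rewrite -sum0 raddf_sum; apply: eq_bigr => l _; rewrite raddfMz.
have := congr1 (fun f : {poly rat} => f`_k) gE.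
rewrite coefMn coef_sum (bigD1 (Ordinal kn)) //= big1 => [|l lk]; last first.
  rewrite coefMrz coefZ coefXn (_ : (k == l) = false) ?mulr0 ?mul0rz //.
  by apply/negbTE; move: lk; rewrite -val_eqE eq_sym.
rewrite addr0 coefMrz coefZ coefXn eqxx mulr1 coef_map /= => E.
have {}E : b k * m = g`_k * o k.
  apply: (@intr_inj rat); rewrite !intrM -E.
  by rewrite -mulrzr -mulr_natr; field.
have : (o k %| b k * m)%Z by apply/dvdzP; exists g`_k.
by rewrite mulrC Gauss_dvdzr // coprimezE coprimeXl // prime_coprime.
Qed.

(** * Independent sequences from elements of order p and large height *)

Lemma greedy_sequence (G : zmodType) (p : nat) (S : nat -> set G) (W0 : seq G) :
  (forall k, ~ finite_set (S k)) ->
  exists x : nat -> G, forall k, S k (x k) /\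
    forall r (a : nat -> nat), r \in W0 -> (forall i, (a i < p)%N) ->
      x k <> r + \sum_(i < k) x i *+ a i.
Proof.
move=> infS.
have /choice[pick pickP] (kW : nat * seq G) : exists z, S kW.1 z /\ z \notin kW.2.
  apply: contrapT => nz; apply: (infS kW.1).
  apply: (@sub_finite_set _ _ [set` kW.2]); last exact: finite_seq.
  move=> z Sz /=; apply: contrapT => /negP zW; apply: nz; exists z; split=> //.
(* [W k] is the finite list of all forbidden combinations of [W0] and the first k terms; the next
   term is picked outside it. *)
pose step k W := [seq w + pick (k, W) *+ j | w <- W, j <- iota 0 p].
pose W := fix W k := if k is l.+1 then step l (W l) else W0.
exists (fun k => pick (k, W k)) => k; have [Sk nW] := pickP (k, W k); split=> // r a rW ap xE.
have inW l : r + \sum_(i < l) pick (i : nat, W i) *+ a i \in W l.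
  elim: l => [|l IHl]; first by rewrite big_ord0 addr0.
  rewrite big_ord_recr /= addrA; apply/allpairsP; exists (r + \sum_(i < l) pick (i : nat, W i) *+ a i, a l).
  by rewrite mem_iota ap.
by move: nW; rewrite /= xE inW.
Qed.

(** The elements of G[p] of p-height at least k; for k = 0 this is G[p] itself. *)
Definition high_socle (G : zmodType) (p k : nat) : set G :=
  [set x | x *+ p = 0 /\ exists y, x = y *+ p ^ k]%classic.
Arguments high_socle : clear implicits.

(** If p did not divide the last coefficient, multiplying by its inverse modulo p would write the
    last x_n as an element of R plus earlier terms with coefficients below p, which the choice of
    x_n forbids. So the last term vanishes and induction applies. *)
Lemma greedy_independent (G : zmodType) (p : nat) (R : G -> Prop) (W0 : seq G)
    (x : nat -> G) :
  prime p -> is_subgroup R -> (forall r, R r -> r \in W0) ->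
  (forall k, x k *+ p = 0) ->
  (forall k r (a : nat -> nat), r \in W0 -> (forall i, (a i < p)%N) ->
      x k <> r + \sum_(i < k) x i *+ a i) ->
  forall n (c : nat -> int), R (\sum_(k < n) x k *~ c k) ->
    forall k, (k < n)%N -> (p %| c k)%Z.
Proof.
move=> pp [R0 RB] RW xp xW.
have RN r : R r -> R (- r) by move=> Rr; rewrite -sub0r; exact: RB.
have RMn r m : R r -> R (r *+ m).
  move=> Rr; elim: m => [|m IHm] //.
  by have := RB _ _ IHm (RN _ Rr); rewrite opprK -mulrSr.
have RMz r (m : int) : R r -> R (r *~ m).
  move=> Rr; case: m => m; first by rewrite -pmulrn; apply: RMn.
  by rewrite NegzE mulrNz -pmulrn; apply: RN; apply: RMn.
have xmod k (m : int) : exists2 a, (a < p)%N & x k *~ m = x k *+ a.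
  exists `|(m %% p)%Z|%N.
    by rewrite -ltz_nat gez0_abs ?modz_ge0 ?ltz_pmod // ?eqz_nat -?lt0n ?ltz_nat ?prime_gt0 // lt0n_neq0 ?prime_gt0.
  rewrite pmulrn gez0_abs ?modz_ge0 ?eqz_nat ?lt0n_neq0 ?prime_gt0 //.
  by rewrite {1}(divz_eq m p) mulrzDr mulrC mulrzA -pmulrn xp mul0rz add0r.
elim=> // n IHn c; rewrite big_ord_recr /= => Rs.
have pc : (p %| c n)%Z.
  apply: contrapT => /negP pc.
  have /coprimezP[[u v] /= uv] : coprimez (c n) p.
    by rewrite coprimezE coprime_sym prime_coprime.
  have /choice[a aP] i : exists a, (a < p)%N /\ x i *~ (- (c i * u)) = x i *+ a.
    by have [a ap aE] := xmod i (- (c i * u)); exists a.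
  apply: (xW n _ a (RW _ (RMz _ u Rs))); first by move=> i; case: (aP i).
  rewrite mulrzDl -mulrzA [c n * u](_ : _ = 1 - v * p); last by rewrite -uv; ring.
  rewrite mulrzBr mulr1z [v * _]mulrC mulrzA -pmulrn xp mul0rz subr0 addrAC.
  rewrite mulrz_suml -big_split big1 ?add0r //= => i _.
  by case: (aP i) => _ <-; rewrite mulrNz mulrzA subrr.
move=> k; rewrite ltnS leq_eqVlt => /orP[/eqP -> //|]; apply: IHn.
have [b cnE] := dvdzP pc; move: Rs.
by rewrite cnE mulrC mulrzA -pmulrn xp mul0rz addr0.
Qed.

Lemma lifted_independent (G : zmodType) (p m : nat) (s : nat -> nat) (W0 : seq G)
    (x y : nat -> G) :
  prime p ->
  (forall r g, r *+ p = 0 -> r = g *+ m -> r \in W0) ->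
  (forall k, x k *+ p = 0) -> (forall k, x k = y k *+ p ^ s k) ->
  (forall k r (a : nat -> nat), r \in W0 -> (forall i, (a i < p)%N) ->
      x k <> r + \sum_(i < k) x i *+ a i) ->
  forall n (c : nat -> int) g, \sum_(k < n) y k *~ c k = g *+ m ->
    forall k, (k < n)%N -> ((p ^ (s k).+1)%N %| c k)%Z.
Proof.
move=> pp W0P xp xE xW.
have sR : is_subgroup (fun r : G => r *+ p = 0 /\ exists g, r = g *+ m).
  split; first by split; [rewrite mul0rn|exists 0; rewrite mul0rn].
  move=> r t [rp [g rE]] [tp [h tE]]; rewrite mulrnBl rp tp subrr; split=> //.
  by exists (g - h); rewrite mulrnBl rE tE.
have RW r : r *+ p = 0 /\ (exists g, r = g *+ m) -> r \in W0.
  by move=> [rp [g]]; exact: W0P.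
have xind := greedy_independent pp sR RW xp xW.
(* Induction on t: applied to p times the relation, it gives that p^(s k) divides c_k. The relation
   then becomes one among the x_k with value in G[p] and mG, and greedy independence supplies the
   missing factor p. A large t makes the premise hold for any c. *)
have main t n (c : nat -> int) g :
    (forall k, (k < n)%N -> ((p ^ (s k).+1)%N %| c k * (p ^ t)%N)%Z) ->
    \sum_(k < n) y k *~ c k = g *+ m ->
    forall k, (k < n)%N -> ((p ^ (s k).+1)%N %| c k)%Z.
  elim: t c g => [|t IHt] c g ct cE k kn; first by have := ct k kn; rewrite mulr1.
  have pcs l : (l < n)%N -> ((p ^ s l)%N %| c l)%Z.
    move=> ln; have : ((p ^ (s l).+1)%N %| c l * p)%Z.
      apply: (IHt (fun l => c l * p) (g *+ p)) => // [i lin|].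
        by have := ct i lin; rewrite expnS PoszM mulrA.
      rewrite -mulrnA mulnC mulrnA -cE -sumrMnl; apply: eq_bigr => i _.
      by rewrite mulrzA -pmulrn.
    by rewrite expnSr PoszM dvdz_mul2r // eqz_nat -lt0n prime_gt0.
  have /choice[d dE] l : exists d : int, (l < n)%N -> c l = d * (p ^ s l)%N%:Z.
    have [ln|] := boolP (l < n)%N; last by exists 0.
    by have /dvdzP[d ->] := pcs l ln; exists d.
  have sE : \sum_(l < n) y l *~ c l = \sum_(l < n) x l *~ d l.
    apply: eq_bigr => l _; rewrite dE // xE mulrC mulrzA -pmulrn.
    by [].
  have /xind /(_ k kn) /dvdzP[b dkE] :
      (\sum_(l < n) x l *~ d l) *+ p = 0 /\ exists g', \sum_(l < n) x l *~ d l = g' *+ m.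
    split; last by exists g; rewrite -sE.
    rewrite -sumrMnl big1 // => l _.
    by rewrite pmulrn -mulrzA mulrC mulrzA -pmulrn xp mul0rz.
  by rewrite dE // dkE -mulrA -PoszM -expnS dvdz_mull.
move=> n c g; apply: (main (\sum_(k < n) (s k).+1)%N) => k kn.
rewrite dvdz_mull // dvdzE /= dvdn_exp2l //.
by rewrite (bigD1 (Ordinal kn)) //= leq_addr.
Qed.

(* Used with (m, alpha) = (0, id) when all high socles are infinite, so that the y_k
   generate an unbounded sum of cyclic groups, and with (p^(n+1), n) when the n-th one
   is the last infinite one. *)
Lemma finitely_Bassian_socle_sequence (G : zmodType) (p m : nat)
    (alpha : nat -> nat) (W0 : seq G) :
  finitely_Bassian G -> prime p ->
  (forall r g : G, r *+ p = 0 -> r = g *+ m -> r \in W0) ->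
  (forall l, (p ^ (alpha l).+1 %| m)%N) ->
  (forall j, exists l, (p ^ j %| p ^ (alpha l).+1)%N \/ (m %| p ^ (alpha l).+1)%N) ->
  ~ forall l, ~ finite_set (high_socle G p (alpha l)).
Proof.
move=> FG pp W0P alm alj inf.
pose s k := alpha (code k).2.
have [x xP] := greedy_sequence p W0 (fun k => inf (code k).2).
have xp k : x k *+ p = 0 by have [[]] := xP k.
have /choice[y xE] k : exists y, x k = y *+ p ^ s k by have [[_]] := xP k.
have xW k := (xP k).2.
have yP := lifted_independent pp W0P xp xE xW.
have yo k : y k *+ p ^ (s k).+1 = 0 by rewrite expnSr mulrnA -xE.
have [E [pi [divE spi torE eE]]] := primary_divisible_group pp.
have [e eind] := eE s.
(* The first component of [code k] proposes an element of E, replaced by 0 unless p^(s k + 1) kills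
   it. The second component determines s k, and by [alj] some value of it admits any given element
   of E[m]. *)
pose c k := let d := pi (code k).1 in if d *+ p ^ (s k).+1 == 0 then d else 0.
have co k : c k *+ p ^ (s k).+1 = 0.
  by rewrite /c; case: eqP => // _; rewrite mul0rn.
apply: (@finitely_Bassian_no_sequence G E m (fun k => p ^ (s k).+1)%N y e c
  (fun l => pickle (0 : {poly rat}, l)) FG divE _ _ eind co).
- move=> k; apply/negP => /eqP pk1; have := ltn_expl (s k).+1 (prime_gt1 pp).
  by rewrite pk1.
- by split=> // n a sum0; apply: (yP n a 0); rewrite mul0rn.
- by move=> k; have [q ->] := dvdnP (alm (code k).2); rewrite mulnC mulrnA co mul0rn.
- move=> d dm; have [f fd] := spi d; have [j dj] := torE d; have [l lP] := alj j.
  exists (pickle (f, l)); rewrite /c /s codeK /= fd; case: eqP => // -[].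
  by case: lP => /dvdnP[q ->]; rewrite mulnC mulrnA ?dj ?dm mul0rn.
- by move=> k l /(pcan_inj pickleK) [].
- by move=> l; rewrite /c codeK /= raddf0; case: ifP.
move=> n a g sE; rewrite big1 // => k _.
have /dvdzP[b ->] := yP n a g sE k (ltn_ord k).
by rewrite mulrC mulrzA -pmulrn yo mul0rz.
Qed.

Lemma finitely_Bassian_finite_annihilated (G : zmodType) p :
  finitely_Bassian G -> prime p -> finite_set (annihilated G p).
Proof.
move=> FG pp; apply: contrapT => inf0.
have [inf|/existsNP[n0 /contrapT fin0]] := pselect (forall k, ~ finite_set (high_socle G p k)).
  apply: (@finitely_Bassian_socle_sequence G p 0 id [:: 0] FG pp) => //.
  - by move=> r g _; rewrite mulr0n inE => /eqP.
  - by move=> j; exists j; left; rewrite dvdn_exp2l.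
have ex : exists n, `[< finite_set (high_socle G p n) >] by exists n0; exact/asboolP.
case: (ex_minnP ex) => -[|n] /asboolP fin nmin.
  by apply: inf0; apply: sub_finite_set fin => x xp; split=> //; exists x.
have /finite_seqP[W0 W0E] := fin.
apply: (@finitely_Bassian_socle_sequence G p (p ^ n.+1) (fun=> n) W0 FG pp) => //.
- move=> r g rp rE; have : high_socle G p n.+1 r by split=> //; exists g.
  by rewrite W0E.
- by move=> j; exists 0%N; right.
by move=> _ /asboolP/nmin; rewrite ltnn.
Qed.

(** * Divisible hulls of finite groups *)

Lemma finite_finZmodType (V : zmodType) : finite_set [set: V]%classic ->
  exists (X : finZmodType) (f : {additive X -> V}),
    injective f /\ forall v, exists x, f x = v.
Proof.
move=> /finite_seqP[s0 s0E]; pose s := undup s0.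
have sP v : v \in s.
  by rewrite mem_undup; have : [set: V]%classic v by []; rewrite s0E.
have pK : pcancel (index^~ s) (onth s).
  by move=> v; rewrite onthE (nth_map 0) ?index_mem // nth_index.
have axF : Finite.axiom (T := V) s.
  by move=> v; rewrite count_uniq_mem ?undup_uniq // sP.
pose X : finZmodType := HB.pack V (isCountable.Build V pK) (isFinite.Build V axF).
have idB : {morph (fun x : X => x : V) : x y / x - y} by [].
have [f fE] := additive_of idB.
by exists X, f; split=> [x y|v]; [rewrite !fE|exists v; rewrite fE].
Qed.

Lemma divisible_subgroup_prime (G : zmodType) (D : zmodClosed G) :
  (forall p x, prime p -> x \in D -> exists2 y, y \in D & y *+ p = x) ->
  divisible_subgroup D.
Proof.
move=> divp n x n0; elim/prime_mul_ind: n / n0 x => [|n p pp _ IHn] x xD.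
  by exists x.
have [y yD yx] := divp p x pp xD; have [z zD zy] := IHn y yD.
by exists z => //; rewrite mulrnA zy.
Qed.

(** The torsion elements of A form a divisible subgroup containing the finite group i(X), so
    minimality applies. *)
Lemma hull_torsion (X : finZmodType) (A : zmodType) (i : {additive X -> A}) :
  divisible A ->
  (forall D : zmodClosed A, divisible_subgroup D ->
     (forall x : X, i x \in D) -> forall a : A, a \in D) ->
  forall a : A, torsion_element a.
Proof.
move=> divA minA a.
have sT : is_subgroup (@torsion_element A).
  split; first by exists 1%N.
  move=> x y [n n0 xn] [m m0 ym]; exists (n * m)%N; first by rewrite muln_gt0 n0.
  by rewrite mulrnBl mulrnA xn mul0rn mulnC mulrnA ym mul0rn subrr.
apply/(in_subgroup sT)/minA.
  move=> n x n0 /in_subgroup[m m0 xm]; have [y yx] := divA n x n0.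
  exists y => //; apply/in_subgroup; exists (n * m)%N; first by rewrite muln_gt0 n0.
  by rewrite mulrnA yx.
move=> x; apply/in_subgroup; exists #[x]%g; first exact: order_gt0.
by rewrite -raddfMn -FinRing.zmodXgE expg_order FinRing.zmod1gE raddf0.
Qed.

(* If a of order p is outside i(X), a subgroup maximal among those containing i(X) and
   avoiding a is divisible, against minimality of A. *)
Lemma hull_socle (X A : zmodType) (i : {additive X -> A}) :
  divisible A ->
  (forall D : zmodClosed A, divisible_subgroup D ->
     (forall x : X, i x \in D) -> forall a : A, a \in D) ->
  forall p (a : A), prime p -> a *+ p = 0 -> exists x, i x = a.
Proof.
move=> divA minA p a pp ap; apply: contrapT => nXa.
pose R0 : set A := [set b | exists x, i x = b]%classic.
have [||M [sM R0M MnB maxM]] := @maximal_subgroup_avoiding _ R0 [set a]%classic.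
- split; first by exists 0; rewrite raddf0.
  by move=> _ _ [x <-] [y <-]; exists (x - y); rewrite raddfB.
- by move=> b [x <-] xa; apply: nXa; exists x.
pose D := subgroup_of sM.
have inD b : b \in D <-> M b by exact: in_subgroup.
suff divD : divisible_subgroup D.
  by apply: (MnB a) => //; apply/inD/minA => // x; apply/inD/R0M; exists x.
apply: divisible_subgroup_prime => q y pq yD.
have [z zy] := divA q y (prime_gt0 pq).
have [zD|zD] := boolP (z \in D); first by exists z.
(* As z is not in D, the larger subgroup D + Zz must contain a by maximality. *)
have [m [k [mD aE]]] : exists m (k : int), m \in D /\ a = m + z *~ k.
  apply: contrapT => nz; move/negP: zD; apply; apply/inD.
  apply: (maxM [set b | exists m (k : int), m \in D /\ b = m + z *~ k]%classic).
  - split; first by exists 0, 0; rewrite mulr0z addr0 rpred0.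
    move=> _ _ [m [k [mD ->]]] [m' [k' [m'D ->]]]; exists (m - m'), (k - k').
    by rewrite rpredB // mulrzBr opprD addrACA.
  - by move=> b /inD bD; exists b, 0; rewrite mulr0z addr0.
  - by move=> _ [m [k [mD ->]]] E; apply: nz; exists m, k.
  - by exists 0, 1; rewrite add0r mulr1z rpred0.
have aD : a \notin D by apply/negP => /inD /MnB; apply.
have qk : ~~ (q %| k)%Z.
  apply: contra aD => /dvdzP[c kE].
  by rewrite aE kE mulrC mulrzA -pmulrn zy rpredD // rpredMz.
have [u [v uv]] : exists u v : int, u * k + v * q = 1.
  have /coprimezP[[u v] /= uv] : coprimez k q.
    by rewrite coprimezE coprime_sym prime_coprime.
  by exists u, v.
have zE : z = (a - m) *~ u + y *~ v.
  by rewrite aE [m + _]addrC addrK -zy pmulrn -!mulrzA -mulrzDr [k * u]mulrC [q%:Z * v]mulrC uv mulr1z.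
(* For q different from p, a is a multiple of q a = q m + k y, which lies in D. *)
have qp : q = p.
  apply: contrapT => /eqP qp; move/negP: aD; apply.
  have cop : coprime q p by rewrite prime_coprime // dvdn_prime2.
  have [u' [v' uv']] := coprime_split cop.
  rewrite (uv' _ a) ap mul0rz addr0 rpredMz // aE mulrnDl rpredD //.
    exact: rpredMn.
  by rewrite pmulrn -mulrzA mulrC mulrzA -pmulrn zy rpredMz.
(* By Bezout z - u a = v y - u m lies in D, and q (z - u a) = y since q = p kills a. *)
exists (z - a *~ u).
  rewrite zE mulrzBl addrAC [X in X + _]addrAC subrr add0r.
  by rewrite rpredD ?rpredN ?rpredMz.
rewrite mulrnBl zy [a *~ u *+ q]pmulrn -mulrzA mulrC mulrzA -pmulrn qp ap.
by rewrite mul0rz subr0.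
Qed.

(** * Characterisation of finitely Bassian groups *)

Theorem theorem2p3 (G : zmodType) :
  finitely_Bassian G <->
  exists A C : zmodType,
    [/\ is_direct_sum G A C,
        exists X : finZmodType, divisible_hull X A
      & Bassian C].
Proof.
split=> [FG|[A [C [[f [g fK gK]] [X [i [inj_i divA minA]]] BC]]]]; last first.
  have FC := Bassian_finitely_Bassian BC.
  have redC := Bassian_reduced BC.
  have torA := hull_torsion divA minA.
  have socA := hull_socle divA minA.
  have inj_f : injective f := can_inj fK.
  have finX : finite_set [set i x | x in [set: X]]%classic.
    by apply: finite_image; exact: finite_finset.
  apply: finitely_Bassian_of_finite.
  - apply: (injective_no_infinite_free_rank inj_f) => h inj_h.
    pose pr : {additive (A * C)%type -> C} := snd.
    apply: (finitely_Bassian_no_free FC (h := pr \o h)); apply: raddf_inj => u /= hu.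
    (* Since A is torsion, a free subgroup of A x C meets A trivially and so projects injectively to
       C. *)
    have [n n0 hn] := torA (h u).1.
    have : u *+ n = 0.
      by apply: inj_h; rewrite raddfMn raddf0 (surjective_pairing (h u)) pairMnE hn hu mul0rn.
    by move/eqP; rewrite -scaler_nat scale_poly_eq0 pnatr_eq0 eqn0Ngt n0 => /eqP.
  - move=> p pp; apply: (injective_finite_annihilated inj_f).
    apply: (sub_finite_set (B := [set i x | x in [set: X]] `*` annihilated C p)%classic).
      move=> [a c]; rewrite /annihilated /= pairMnE => -[ap cp]; split=> //=.
      by have [x xa] := socA p a pp ap; exists x.
    apply: finite_setX => //.
    exact: finitely_Bassian_finite_annihilated.
  - apply: (injective_divisible_socle inj_f).
    apply: (sub_finite_set (B := [set i x | x in [set: X]] `*` [set 0])%classic).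
      move=> [a c] [acD [p pp]]; rewrite pairMnE => -[ap cp]; split=> /=.
        by have [x xa] := socA p a pp ap; exists x.
      exact/redC/(torsion_divisible_morph (snd : {additive (A * C)%type -> C}) acD).
    by apply: finite_setX => //; exact: finite_set1.
pose A := subgroup_type (divisible_torsion G).
have divA : divisible A by exact: divisible_torsion_divisible.
have nfG := finitely_Bassian_no_free FG.
have finG p : prime p -> finite_set (annihilated G p).
  exact: finitely_Bassian_finite_annihilated.
(* Extending the identity of D gives a retraction [rho], whose kernel is the complement C. *)
have [a|rho rhoE] := @additive_extension A G A val idfun divA.
  by move=> a0; apply: val_inj.
have sC : is_subgroup (fun x => rho x = 0).
  by split=> [|x y rx ry]; rewrite ?raddf0 // raddfB rx ry subrr.
pose C := subgroup_type (subgroup_of sC).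
have valC (c : C) : rho (val c) = 0.
  by case: c => c cC; exact: (in_subgroup sC c).1 cC.
exists A, C; split.
- have cP x : x - val (rho x) \in subgroup_of sC.
    by apply/in_subgroup; rewrite raddfB rhoE subrr.
  have fB : {morph (fun x => (rho x, SubgroupElt (cP x) : C)) : x y / x - y}.
    move=> x y; rewrite pairBE; congr (_, _); first exact: raddfB.
    apply: val_inj.
    rewrite [RHS]raddfB; change (x - y - val (rho (x - y)) =
      (x - val (rho x)) - (y - val (rho y))).
    by rewrite !raddfB addrACA.
  have [f fE] := additive_of fB; exists f.
  exists (fun z => val z.1 + val z.2) => [x|[a c]]; rewrite fE.
    by rewrite /= addrC subrK.
  have ra : rho (val a + val c) = a by rewrite raddfD rhoE valC addr0.
  congr (_, _) => //; apply: val_inj.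
  change (val a + val c - val (rho (val a + val c)) = val c).
  by rewrite ra addrC addKr.
- have /finite_seqP[s sE] := finite_divisible_socle FG.
  have [n n0 nP] : exists2 n, (0 < n)%N & forall x, x \in s -> x *+ n = 0.
    apply: common_annihilator => x xs.
    by have [[]] : divisible_socle G x by rewrite sE.
  have socA p (b : A) : prime p -> b *+ p = 0 -> b *+ n = 0.
    move=> pp bp; apply: val_inj; rewrite raddfMn; apply: nP.
    have : divisible_socle G (val b).
      case: b bp => b bD bp; split.
        exact: (in_subgroup (torsion_divisible_subgroup G) b).1 bD.
      by exists p => //; have := congr1 val bp; rewrite raddfMn.
    by rewrite sE.
  have sX : is_subgroup (fun b : A => b *+ n = 0).
    by split=> [|b c bn cn]; rewrite ?mul0rn // mulrnBl bn cn subrr.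
  (* The finite group whose hull is A is A[n], which contains every element of prime order in A. *)
  pose X0 := subgroup_type (subgroup_of sX).
  have finX0 : finite_set [set: X0]%classic.
    have finA : finite_set (annihilated A n).
      apply: (injective_finite_annihilated (f := val : {additive A -> G}) val_inj).
      exact: finite_annihilated.
    have := finite_preimage (f := val : X0 -> A) (in2W val_inj) finA.
    by apply: sub_finite_set => -[b bX] _; exact: (in_subgroup sX b).1 bX.
  have [X [f [inj_f sf]]] := finite_finZmodType finX0.
  exists X, (val \o f); split=> //; first exact: inj_comp val_inj inj_f.
  move=> D divD XD b.
  have torA (c : A) : torsion_element c.
    case: c => c cD; have /in_subgroup[[m m0 cm] _] := cD.
    by exists m => //; apply: val_inj; rewrite raddfMn.
  have socD p (c : A) : prime p -> c *+ p = 0 -> c \in D.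
    move=> pp cp; have cX : c \in subgroup_of sX.
      by apply/in_subgroup; exact: socA cp.
    by have [x xc] := sf (SubgroupElt cX : X0); have := XD x; rewrite /= xc.
  (* Induction on an annihilator of b: p b lies in D, so p b = p d with d in D, and b - d is killed
     by p, hence lies in X and so in D. *)
  have [m m0] := torA b; elim/prime_mul_ind: m / m0 b => [b b0|m p pp _ IHm b bm].
    by rewrite -[b]mulr1n b0 rpred0.
  have bpD : b *+ p \in D by apply: IHm; rewrite -mulrnA mulnC.
  have [d dD dp] := divD p _ (prime_gt0 pp) bpD.
  rewrite -[b](subrK d) rpredD //; apply: (socD p) => //.
  by rewrite mulrnBl dp subrr.
- apply: reduced_Bassian.
  + exact: (injective_no_infinite_free_rank (f := val : {additive C -> G}) val_inj).
  + move=> p /finG; exact: (injective_finite_annihilated (f := val : {additive C -> G}) val_inj).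
  (* A divisible torsion element of C is fixed by [rho] and also killed by it. *)
  + move=> c /(torsion_divisible_morph (val : {additive C -> G})) /= cD.
    have cA : val c \in divisible_torsion G by apply/in_subgroup.
    have := valC c; have -> : val c = val (SubgroupElt cA : A) by [].
    rewrite rhoE => /(congr1 val) /= c0; exact: val_inj.
Qed.
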